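(* Let $\mathbb{V}=(V_1,\dots,V_n)$ be a completely non-unitary $n$-tuple of commuting isometries on a Hilbert space $\mathcal{H}$, and let $\mathcal{I}\subseteq \operatorname{Ann}(\mathbb{V})$ be an ideal of $\mathbb{C}[X_1,\dots,X_n]$ such that $\dim Z(\mathcal{I})=1$. (1) $\mathcal{I}=\operatorname{Ann}(\mathbb{V})$ if and only if $\mathcal{I}$ is radical and, writing $\mathcal{I}_1,\dots,\mathcal{I}_m$ for the prime factors of $\mathcal{I}$, one has $\bigcap_{i\neq j}\mathcal{I}_i\nsubseteq \operatorname{Ann}(\mathbb{V})$ for every $j\in\{1,\dots,m\}$. (2) If $\mathcal{I}=\operatorname{Ann}(\mathbb{V})$ (so that $\mathcal{I}$ is radical), with prime factors $\mathcal{I}_1,\dots,\mathcal{I}_m$, then there exist non-zero, mutually orthogonal $\mathbb{V}$-invariant subspaces $\mathcal{H}_1,\dots,\mathcal{H}_m$ of $\mathcal{H}$ such that $\mathcal{I}_j=\operatorname{Ann}(\mathbb{V}|\mathcal{H}_j)$ for each $j\in\{1,\dots,m\}$.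
   Context: Hilbert spaces are complex, subspaces are closed, and $n$ is a positive integer. For an $n$-tuple $\mathbb{V}=(V_1,\dots,V_n)$ of commuting isometries on $\mathcal{H}$ and $p\in\mathbb{C}[X_1,\dots,X_n]$, $p(\mathbb{V})=p(V_1,\dots,V_n)$, and $\operatorname{Ann}(\mathbb{V})=\{p\in\mathbb{C}[X_1,\dots,X_n]:p(\mathbb{V})=0\}$. A subspace $\mathcal{K}$ is $\mathbb{V}$-invariant (resp. $\mathbb{V}$-reducing) if it is invariant (resp. reducing) for every $V_i$; then $\mathbb{V}|\mathcal{K}=(V_1|\mathcal{K},\dots,V_n|\mathcal{K})$. $\mathbb{V}$ is completely non-unitary if there is no non-zero $\mathbb{V}$-reducing subspace $\mathcal{K}$ such that $V_i|\mathcal{K}$ is unitary for every $i=1,\dots,n$. For a set $S$ of polynomials, $Z(S)=\{z\in\mathbb{C}^n:p(z)=0\text{ for all }p\in S\}$, and $\dim$ is the dimension as a complex algebraic variety. A radical ideal $\mathcal{I}$ is uniquely the irredundant intersection of finitely many prime ideals $\mathcal{I}_1,\dots,\mathcal{I}_m$ (i.e. $\bigcap_i\mathcal{I}_i=\mathcal{I}$ and $\bigcap_{i\ne j}\mathcal{I}_i\supsetneq\mathcal{I}$ for each $j$); these are its prime factors. An empty intersection of ideals (case $m=1$) is $\mathbb{C}[X_1,\dots,X_n]$. *)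

(* Defs.v *)
From mathcomp Require Import all_boot all_order all_algebra.
From mathcomp Require Import all_classical all_reals all_analysis.
From mathcomp Require Export complex.
(* mpoly's notations clash with those of mathcomp-analysis. *)
From mathcomp Require Export -(notations) mpoly.
Import Order.TTheory GRing.Theory Num.Theory.
Import numFieldNormedType.Exports.

Set Implicit Arguments.
Unset Strict Implicit.
Unset Printing Implicit Defensive.

Local Open Scope classical_set_scope.
Local Open Scope complex_scope.
Local Open Scope ring_scope.

Section Ideals.
Context {A : comNzRingType}.
Implicit Types I : set A.

(* Unlike ring_quotient's [idealr], the ideal need not be proper. *)
Definition is_ideal I :=
  I 0 /\ forall a p q, I p -> I q -> I (a * p + q).

Definition is_prime_ideal I :=
  [/\ is_ideal I, ~ I 1 & forall p q, I (p * q) -> I p \/ I q].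

Definition is_radical I :=
  is_ideal I /\ forall p k, I (p ^+ k) -> I p.

(* The intersection of all [P i] with [i != j]; it is [setT] if there is no
   such [i]. *)
Definition bigcap_except m (P : 'I_m -> set A) (j : 'I_m) : set A :=
  \bigcap_(i in [set i | i != j]) P i.

Definition are_prime_factors I m (P : 'I_m -> set A) :=
  [/\ forall i, is_prime_ideal (P i),
      \bigcap_i P i = I
    & forall j, I `<` bigcap_except P j].

End Ideals.

Section Varieties.
Context {K : fieldType} {n : nat}.
Implicit Types X : set ('I_n -> K).

Definition zeros (S : set (mpoly n K)) : set ('I_n -> K) :=
  [set z | forall p, S p -> meval z p = 0].

Definition zariski_closed X := exists S, X = zeros S.

Definition zariski_irreducible X :=
  X !=set0 /\
  forall X1 X2, zariski_closed X1 -> zariski_closed X2 ->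
    X `<=` X1 `|` X2 -> X `<=` X1 \/ X `<=` X2.

Definition has_irreducible_chain X (d : nat) :=
  exists Y : nat -> set ('I_n -> K),
    (forall k, (k <= d)%N ->
      [/\ zariski_closed (Y k), zariski_irreducible (Y k) & Y k `<=` X]) /\
    (forall k, (k < d)%N -> Y k `<` Y k.+1).

(* The dimension of an algebraic set is the Krull dimension of its Zariski
   topology; the empty set has no dimension in nat. *)
Definition has_dim X (d : nat) :=
  has_irreducible_chain X d /\
  forall e, has_irreducible_chain X e -> (e <= d)%N.

End Varieties.

Section Tuples.
Context {K : fieldType} {H : lmodType K} {n : nat}.
Implicit Types (V : 'I_n -> {linear H -> H}) (L : set H).

Definition commuting V := forall i j x, V i (V j x) = V j (V i x).

Definition monomial_op V (m : multinom n) : H -> H :=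
  \big[@comp H H H/idfun]_(i < n) iter (m i) (V i).

Definition poly_op V (p : mpoly n K) (x : H) : H :=
  \sum_(m <- msupp p) mcoeff m p *: monomial_op V m x.

Definition is_invariant V L := forall i x, L x -> L (V i x).

(* For a [V]-invariant subspace [L] this is Ann(V|L), since p(V|L) is the
   restriction of p(V) to [L]. *)
Definition ann_on V L : set (mpoly n K) :=
  [set p | forall x, L x -> poly_op V p x = 0].

Definition ann V := ann_on V setT.

End Tuples.

Section Hilbert.
Context {R : realType} {H : completeNormedModType R[i]}.
Variable dot : {dot H for Num.conj}.
Implicit Types (L : set H) (T : {linear H -> H}).

(* [H] is complete for its norm, so this makes it a Hilbert space with inner
   product [dot]. *)
Definition inner_product_of_norm := forall x : H, dot x x = `|x| ^+ 2.

Definition is_subspace L :=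
  [/\ L 0, (forall (a : R[i]) x y, L x -> L y -> L (a *: x + y)) & closed L].

Definition orthocomp L : set H := [set y | forall x, L x -> dot x y = 0].

Definition unitary_on L T :=
  (forall x y, L x -> L y -> dot (T x) (T y) = dot x y) /\ T @` L = L.

Definition reducing n (V : 'I_n -> {linear H -> H}) L :=
  [/\ is_subspace L, is_invariant V L & is_invariant V (orthocomp L)].

Definition completely_non_unitary n (V : 'I_n -> {linear H -> H}) :=
  ~ exists L, [/\ reducing V L, L <> [set 0] & forall i, unitary_on L (V i)].

End Hilbert.

(* Main.v *)
Require Import Defs.
From mathcomp Require Import all_boot all_order all_algebra.
From mathcomp Require Import all_classical all_reals all_analysis.
From mathcomp Require Import ring.
Import Order.TTheory GRing.Theory Num.Theory.
Import numFieldNormedType.Exports.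

(** Everything rests on one identity. If [p] is a polynomial and [m] is a
    monomial divisible by all the monomials of [p], then reversing [p] inside
    [m] and conjugating its coefficients gives a polynomial [q] with
    [m(V)^* p(V) = q(V)^*]: for commuting isometries the inner product of two
    monomials applied to two vectors is unchanged when both are multiplied by
    a third one. As [p(V)] and [q(V)] commute, [q(V) x] and [p(V) x] have the
    same norm, which is what normality of [p(U)] would give on a commuting
    unitary extension [U] of [V]. Hence [p q] in Ann(V) makes the ranges of
    [p(V)] and [q(V)] orthogonal ([ann_mul_orth]). With [p = q] this says that
    Ann(V) is radical ([ann_radical]), so that, the polynomial ring being
    noetherian, it has prime factors.

    For the second assertion take [p_j] in all the prime factors but the
    [j]-th, outside [I], and let [L_j] be the closure of the range of
    [p_j(V)]. A polynomial [q] vanishes on [L_j] iff [q p_j] is in Ann(V) = [I],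
    that is iff [q] is in [P_j]; and [p_j p_k] is in [I] for [j <> k], so the
    [L_j] are orthogonal.

    For the converse in the first assertion, let [q] be in Ann(V), outside
    some [P_j], and let [p] be in all the other prime factors. Then [P_j + (q)]
    vanishes on the closure [L] of the range of [p(V)]. As Z(I) has dimension
    one, [P_j + (q)] contains a non-zero polynomial in each single variable
    ([dim1_univariate]), so every [V_i] is algebraic on [L]. An algebraic
    isometry is onto, hence [L] is reducing and [V] is unitary on it
    ([algebraic_reducing_unitary]); complete non-unitarity forces [L = 0],
    that is [p] in Ann(V). So the intersection of the other factors would be
    contained in Ann(V).

    [dim1_univariate] is where the variety enters: otherwise some prime
    [Q] containing [P_j + (q)] would meet the polynomials in one variable [X_i]
    only in [0], and a point of Z(Q), Z(Q) and Z(P_j) would be a strict chain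
    of irreducible closed sets. The strictness needs the Nullstellensatz, which
    for an uncountable field is a counting argument ([prime_coordinate]). *)

Set Implicit Arguments.
Unset Strict Implicit.
Unset Printing Implicit Defensive.

Local Open Scope classical_set_scope.
Local Open Scope complex_scope.
Local Open Scope ring_scope.

(** * Ideals in noetherian rings *)

Section IdealTheory.
Context {A : comNzRingType}.
Implicit Types (J M S : set A) (a p q : A).

Lemma ideal0 J : is_ideal J -> J 0.
Proof. by case. Qed.

Lemma ideal_mull J a p : is_ideal J -> J p -> J (a * p).
Proof. by move=> [J0 JP] Jp; rewrite -[a * p]addr0; exact: JP. Qed.

Lemma ideal_mulr J p a : is_ideal J -> J p -> J (p * a).
Proof. by rewrite mulrC; exact: ideal_mull. Qed.

Lemma ideal_add J p q : is_ideal J -> J p -> J q -> J (p + q).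
Proof. by move=> [J0 JP] Jp Jq; rewrite -[p]mul1r; exact: JP. Qed.

Lemma ideal_sub J p q : is_ideal J -> J p -> J q -> J (p - q).
Proof.
by move=> Ji Jp Jq; apply: ideal_add => //; rewrite -mulN1r; exact: ideal_mull.
Qed.

Lemma ideal_sum J (T : Type) (r : seq T) (F : T -> A) :
  is_ideal J -> (forall t, J (F t)) -> J (\sum_(t <- r) F t).
Proof.
move=> Ji JF; apply: (big_ind J) => //; first exact: ideal0.
by move=> x y; exact: ideal_add.
Qed.

Lemma ideal1 J : is_ideal J -> J 1 -> J = setT.
Proof.
move=> Ji J1; apply/seteqP; split => // p _.
by rewrite -[p]mulr1; exact: ideal_mull.
Qed.

Definition ideal_adjoin J a : set A := [set p | exists b, J (p - b * a)].

Lemma ideal_adjoinP J a : is_ideal J ->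
  [/\ is_ideal (ideal_adjoin J a), J `<=` ideal_adjoin J a & ideal_adjoin J a a].
Proof.
move=> Ji; split; first split.
- by exists 0; rewrite mul0r subr0; exact: ideal0.
- move=> c p q [b1 Jb1] [b2 Jb2]; exists (c * b1 + b2).
  have -> : c * p + q - (c * b1 + b2) * a =
            c * (p - b1 * a) + (q - b2 * a) by ring.
  by case: Ji => _; apply.
- by move=> p Jp; exists 0; rewrite mul0r subr0.
- by exists 1; rewrite mul1r subrr; exact: ideal0.
Qed.

Lemma prime_is_ideal J : is_prime_ideal J -> is_ideal J.
Proof. by case. Qed.

Lemma primeX J p k : is_prime_ideal J -> J (p ^+ k) -> J p.
Proof.
move=> [Ji J1 JM]; elim: k => [/J1 //|k IHk].
by rewrite exprS => /JM[].
Qed.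

Definition colon J S : set A := [set p | forall s, S s -> J (p * s)].

Lemma sub_colon J S : is_ideal J -> J `<=` colon J S.
Proof. by move=> Ji p Jp s _; rewrite mulrC; exact: ideal_mull. Qed.

(** A power of [p] times [s] in [J] makes a power of [p * s] lie in [J]. *)
Lemma colon_radical J S : is_radical J -> is_radical (colon J S).
Proof.
move=> [Ji Jrad]; split; first split.
- by move=> s _; rewrite mul0r; exact: ideal0.
- move=> c p q cp cq s Ss; rewrite mulrDl -mulrA.
  by apply: ideal_add => //; [apply: ideal_mull => //; exact: cp|exact: cq].
move=> p k cpk s Ss; apply: (Jrad _ k.+1).
rewrite exprMn exprSr [s ^+ _]exprS.
have -> : p ^+ k * p * (s * s ^+ k) = (p * s ^+ k) * (p ^+ k * s) by ring.
by apply: ideal_mull => //; exact: cpk.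
Qed.

(** If [p ^+ k.+2] is in [J], so is the square of [p ^+ k.+1]. *)
Lemma radical_of_square J : is_ideal J ->
  (forall p, J (p * p) -> J p) -> is_radical J.
Proof.
move=> Ji Jsq; split=> // p; elim=> [|k IHk] Jpk.
  by rewrite -[p]mulr1; exact: ideal_mull.
case: k IHk Jpk => [|k] IHk Jpk; first by rewrite -[p]expr1.
apply/IHk/Jsq; have -> : p ^+ k.+1 * p ^+ k.+1 = p ^+ k * p ^+ k.+2.
  by rewrite !exprS; ring.
exact: ideal_mull.
Qed.

Definition multiplicative_set S :=
  S 1 /\ forall s t, S s -> S t -> S (s * t).

End IdealTheory.

Definition noetherian (A : comNzRingType) := forall J : nat -> set A,
  (forall k, is_ideal (J k)) -> (forall k, J k `<=` J k.+1) ->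
  exists k, J k.+1 = J k.

Section NoetherianTheory.
Context {A : comNzRingType} (noethA : noetherian A).
Implicit Types (J M S : set A) (a p q : A).

Lemma noetherian_maximal (F : set (set A)) :
  F `<=` is_ideal -> F !=set0 ->
  exists2 M, F M & forall J, F J -> M `<=` J -> J = M.
Proof.
move=> Fi [M0 FM0]; apply: contrapT => nomax.
have /choice[next nextP] (M : {M | F M}) :
    exists J : {J | F J}, sval M `<=` sval J /\ sval J <> sval M.
  case: M => M FM /=; apply: contrapT => noJ; apply: nomax; exists M => //.
  move=> J FJ MJ; apply: contrapT => JM; apply: noJ.
  by exists (exist _ J FJ).
pose J k := sval (iter k next (exist _ M0 FM0)).
have [k Jk] : exists k, J k.+1 = J k.
  by apply: noethA => k; [exact: Fi (svalP _)|exact: (nextP _).1].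
exact: (nextP _).2 Jk.
Qed.

(** An ideal maximal among those that contain [J] and avoid [S] is prime. The
    last clause records the maximality: adjoining any element to [M] makes it
    meet [S], that is, every non-zero element of the quotient becomes
    invertible once [S] is inverted. *)
Lemma prime_disjoint S J :
  multiplicative_set S -> is_ideal J -> (forall s, S s -> ~ J s) ->
  exists M, [/\ is_prime_ideal M, J `<=` M, forall s, S s -> ~ M s
    & forall p, ~ M p -> exists s a, S s /\ M (s - a * p)].
Proof.
move=> [S1 SM] Ji JS.
pose F M := [/\ is_ideal M, J `<=` M & forall s, S s -> ~ M s].
have [M [Mi JM MS] Mmax] : exists2 M, F M & forall N, F N -> M `<=` N -> N = M.
  by apply: noetherian_maximal; [move=> ? []|exists J; split].
have meet p : ~ M p -> exists s a, S s /\ M (s - a * p).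
  move=> Mp; apply: contrapT => nos.
  have [Ni MN Np] := ideal_adjoinP p Mi.
  apply: Mp; rewrite -(Mmax _ _ MN) //; split=> //; first exact: subset_trans MN.
  by move=> s Ss [a Ma]; apply: nos; exists s, a.
exists M; split=> //; split=> // [|p q Mpq]; first exact: MS.
apply: contrapT => /not_orP[/meet[s [a [Ss Ms]]] /meet[t [b [St Mt]]]].
apply: (MS (s * t)); first exact: SM.
have -> : s * t = t * (s - a * p) + (a * p * (t - b * q) + a * b * (p * q))
  by ring.
by do ![apply: ideal_add => // | apply: ideal_mull => //].
Qed.

(** Noetherian induction. If [a * b] is in a radical ideal [M] but neither
    factor is, then [colon M [set a]] and its own colon ideal
    [colon M (colon M [set a])] are strictly larger radical ideals, containing
    [b] and [a] respectively, and they meet in [M] because the square of a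
    common element is in [M]. *)
Lemma radical_bigcap_primes J : is_radical J ->
  exists m (P : 'I_m -> set A),
    (forall i, is_prime_ideal (P i)) /\ \bigcap_i P i = J.
Proof.
pose dec J := exists m (P : 'I_m -> set A),
  (forall i, is_prime_ideal (P i)) /\ \bigcap_i P i = J.
move=> Jrad; apply: contrapT => Jndec.
have [M [Mrad Mndec] Mmax] :
    exists2 M, is_radical M /\ ~ dec M &
      forall N, is_radical N /\ ~ dec N -> M `<=` N -> N = M.
  by apply: (@noetherian_maximal [set M | is_radical M /\ ~ dec M]);
    [move=> ? [[]]|exists J].
have Mi := Mrad.1; apply: Mndec.
have [M1|M1] := pselect (M 1).
  exists 0%N, (fun=> setT); split=> [i|]; first by case: i.
  by rewrite (ideal1 Mi M1); apply/seteqP; split.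
have [Mp|] := pselect (is_prime_ideal M).
  by exists 1%N, (fun=> M); split=> //; apply/seteqP; split=> [x /(_ ord0)|x Mx ?];
    exact.
move=> Mnp; have [a [b [Mab Ma Mb]]] : exists a b, [/\ M (a * b), ~ M a & ~ M b].
  apply: contrapT => nab; apply: Mnp; split=> // p q Mpq.
  by apply: contrapT => /not_orP[? ?]; apply: nab; exists p, q.
pose N1 := colon M [set a]; pose N2 := colon M N1.
have decS (N : set A) c : is_radical N -> M `<=` N -> N c -> ~ M c -> dec N.
  by move=> Nr MN Nc Mc; apply: contrapT => Nnd; apply: Mc; rewrite -(Mmax N).
have [m1 [P1 [P1p P1M]]] : dec N1.
  apply: (decS _ b) => //; [exact: colon_radical|exact: sub_colon|].
  by move=> _ ->; rewrite mulrC.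
have [m2 [P2 [P2p P2M]]] : dec N2.
  apply: (decS _ a) => //; [exact: colon_radical|exact: sub_colon|].
  by move=> s; rewrite mulrC; apply.
exists (m1 + m2)%N,
  (fun i => match fintype.split i with inl j => P1 j | inr j => P2 j end).
split=> [i|]; first by case: fintype.split.
apply/seteqP; split=> x.
  move=> Px; apply: (Mrad.2 _ 2); rewrite expr2.
  have : N2 x.
    by rewrite -P2M => j _; have := Px (unsplit (inr j)) I; rewrite unsplitK.
  apply; rewrite -P1M => j _.
  by have := Px (unsplit (inl j)) I; rewrite unsplitK.
move=> Mx i _; case: fintype.split => j.
  by have := @sub_colon _ M [set a] Mi x Mx; rewrite -/N1 -P1M; exact.
by have := @sub_colon _ M N1 Mi x Mx; rewrite -/N2 -P2M; exact.
Qed.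

(** Drop redundant primes one by one. *)
Lemma radical_prime_factors J : is_radical J ->
  exists m (P : 'I_m -> set A), are_prime_factors J P.
Proof.
move=> /radical_bigcap_primes[m]; elim: m => [|m IHm] [P [Pp PJ]].
  by exists 0%N, P; split=> // j; case: j.
have [irr|] := pselect (forall j, J `<` bigcap_except P j).
  by exists m.+1, P.
move=> /existsNP[j red]; apply: IHm; exists (fun i => P (lift j i)).
split=> // ; apply/seteqP; split=> x; last first.
  by rewrite -PJ => Px i _; exact: Px.
move=> Px; apply: contrapT => Jx; apply: red; split.
  by rewrite -PJ => y Py i _; exact: Py.
move=> /(_ x); apply: contra_not Jx; apply => i /= ij.
by rewrite eq_sym in ij; have [k -> _] := unlift_some ij; exact: Px.
Qed.

End NoetherianTheory.

(** * The polynomial ring is noetherian *)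

(** Always move on to a place where the minimum of the remaining values is
    attained. *)
Lemma nondecreasing_subsequence (u : nat -> nat) :
  exists s : nat -> nat, {homo s : i j / (i < j)%N} /\
    {homo u \o s : i j / (i <= j)%N}.
Proof.
have /choice[f fP] N : exists i, (N <= i)%N /\
    forall j, (N <= j)%N -> (u i <= u j)%N.
  have exu : exists v, `[< exists2 i, (N <= i)%N & u i = v >].
    by exists (u N); apply/asboolP; exists N.
  case: (ex_minnP exu) => v /asboolP[i Ni <-] umin; exists i; split=> // j Nj.
  by apply: umin; apply/asboolP; exists j.
pose s k := iter k (fun i => f i.+1) (f 0%N).
have s_lt k : (s k < s k.+1)%N by rewrite /s /= (fP _).1.
exists s; split; first by apply: homo_ltn => //; exact: ltn_trans.
apply: homo_leq => [//|m n p|k /=]; first exact: leq_trans.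
case: k (s_lt k) => [|k] sk; first exact: (fP 0%N).2.
apply: (fP _).2; exact: ltn_trans (s_lt k) sk.
Qed.

(** Extract monotone subsequences for the coordinates one after the other. *)
Lemma dickson (I : finType) (u : nat -> I -> nat) :
  exists i j, (i < j)%N /\ forall c, (u i c <= u j c)%N.
Proof.
suff [s [s_inc us]] : exists s : nat -> nat, {homo s : i j / (i < j)%N} /\
    forall c, c \in enum I -> {homo (fun k => u (s k) c) : i j / (i <= j)%N}.
  exists (s 0%N), (s 1%N); split=> [|c]; first exact: s_inc.
  by apply: us => //; rewrite mem_enum.
elim: (enum I) => [|c r [s [s_inc us]]]; first by exists id; split.
have [t [t_inc ut]] := nondecreasing_subsequence (fun k => u (s k) c).
exists (s \o t); split=> [i j ij /=|d]; first by apply: s_inc; exact: t_inc.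
rewrite inE => /predU1P[->|dr] i j ij /=; first exact: ut.
by apply: us => //; exact: (ltnW_homo t_inc).
Qed.

Section HilbertBasis.
Context {K : fieldType} {n : nat}.
Implicit Types p q : mpoly n K.

(** The division step: a multiple of [p] cancels the leading term of [q]. *)
Lemma mlead_reduce p q : p != 0 -> q != 0 ->
    (forall c, (mlead p c <= mlead q c)%N) ->
  exists a, q - a * p = 0 \/ (mlead (q - a * p) < mlead q)%O.
Proof.
move=> p0 q0 lepq.
set m := mnm_sub (mlead q) (mlead p).
have mE : mnm_add m (mlead p) = mlead q by apply/submK/mnm_lepP.
pose c := mcoeff (mlead q) q / mcoeff (mlead p) p.
have c0 : c != 0 by rewrite mulf_neq0 ?invr_eq0 // mleadc_eq0.
exists (c *: mpolyX K m); set r := q - _.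
have Xm0 : mpolyX K m != 0.
  by apply/eqP => /(congr1 (mcoeff m)); rewrite mcoeffX eqxx mcoeff0 => /eqP;
    rewrite oner_eq0.
have [r0|r0] := eqVneq r 0; [by left|right].
rewrite lt_neqAle; apply/andP; split; last first.
  apply: le_trans (mleadB_le _ _) _.
  by rewrite -scalerAl mleadZ // mleadM // mleadXm mE joinxx.
apply/eqP => eqr; move: r0; rewrite -mleadc_eq0 eqr mcoeffB -scalerAl mcoeffZ.
rewrite [_ * p]mulrC -[X in mcoeff X (_ * _)]mE mcoeffMX divfK ?mleadc_eq0 //.
by rewrite subrr eqxx.
Qed.

(** In a strictly ascending chain, choose in each step [J k.+1] minus [J k] an
    element [p k] with the least possible leading monomial. By Dickson's lemma
    some leading monomial divides a later one, and a division step then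
    produces a competitor with a smaller leading monomial. *)
Theorem mpoly_noetherian : noetherian (mpoly n K).
Proof.
move=> J Ji Jsub; apply: contrapT => /forallNP Jneq.
have Jmono i j : (i <= j)%N -> J i `<=` J j.
  by apply: homo_leq => [x //|x y z|//]; exact: subset_trans.
have /choice[p pP] k : exists p, [/\ J k.+1 p, ~ J k p &
    forall q, J k.+1 q -> ~ J k q -> (mlead p <= mlead q)%O].
  have [q Jq Jkq] : exists2 q, J k.+1 q & ~ J k q.
    apply: contrapT => noq; apply: (Jneq k); apply/seteqP; split=> // q Jq.
    by apply: contrapT => Jkq; apply: noq; exists q.
  have [m mq] : exists m, mlead q = m by exists (mlead q).
  elim/(@ltmwf n): m q mq Jq Jkq => m IHm q mq Jq Jkq.
  have [qmin|] :=
    pselect (forall r, J k.+1 r -> ~ J k r -> (mlead q <= mlead r)%O).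
    by exists q.
  move=> /existsNP[r /not_implyP[Jr /not_implyP[Jkr /negP]]].
  by rewrite -ltNge mq => rm; exact: (IHm _ rm r).
have [i [j [ij lepij]]] := dickson (fun k => mlead (p k)).
have [Ji1 Jip _] := pP i; have [Jj1 Jjp jmin] := pP j.
have p0 k : p k != 0.
  by have [_ Jkp _] := pP k; apply/eqP => pk0; apply: Jkp;
    rewrite pk0; exact: ideal0.
have Jjpi : J j (p i) by exact: Jmono Ji1.
have [a red] := mlead_reduce (p0 i) (p0 j) lepij.
have Jr : ~ J j (p j - a * p i).
  move=> Jr; apply: Jjp; rewrite -[p j](subrK (a * p i)).
  by apply: ideal_add => //; exact: ideal_mull.
case: red => [r0|]; first by apply: Jr; rewrite r0; exact: ideal0.
apply/negP; rewrite -leNgt; apply: jmin => //.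
by apply: ideal_sub => //; apply: ideal_mull => //; exact: Jsub.
Qed.

End HilbertBasis.

(** * Nullstellensatz over an uncountable field, and dimension one *)

Local Notation poly_in i := (horner_alg (mpolyX _ (mnm1 i))).

Section Nullstellensatz.
Context {K : closedFieldType} {n : nat}.
Implicit Types (M P Q : set (mpoly n K)) (f g p q : mpoly n K).

(** The polynomials of bounded degree form a finite-dimensional space. *)
Lemma mpoly_dependence d N (g : 'I_N -> mpoly n K) :
    (forall i, (mmeasure mdeg (g i) <= d)%N) -> (#|{: bmultinom n d}| < N)%N ->
  exists a : 'I_N -> K, (exists i, a i != 0) /\ \sum_i a i *: g i = 0.
Proof.
move=> gd dN.
pose B : 'M[K]_(N, #|{: bmultinom n d}|) :=
  \matrix_(i, j) mcoeff (enum_val j : bmultinom n d) (g i).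
have : kermx B != 0.
  by rewrite kermx_eq0 /row_free neq_ltn (leq_ltn_trans (rank_leq_col B) dN).
move=> /rowV0Pn[v /sub_kermxP vB v0].
exists (v 0); split; first exact/rV0Pn.
apply/mpolyP => m; rewrite mcoeff0 raddf_sum /=.
under eq_bigr do rewrite mcoeffZ.
have [md|md] := ltnP (mdeg m) d.
  transitivity ((v *m B) 0 (enum_rank (BMultinom md))); last by rewrite vB mxE.
  by rewrite mxE; apply: eq_bigr => i _; rewrite mxE enum_rankK.
apply: big1 => i _; rewrite memN_msupp_eq0 ?mulr0 //.
by apply: msize_mdeg_ge; exact: leq_trans (gd i) md.
Qed.

Lemma prime_mpolyC P c : is_prime_ideal P -> P (mpolyC n c) -> c = 0.
Proof.
move=> [Pi P1 _] Pc; apply: contrapT => /eqP c0; apply: P1.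
rewrite -[1](mpolyC1 n K) -[in mpolyC _ 1](mulVf c0) mpolyCM; exact: ideal_mull.
Qed.

Lemma poly_inZ i c (h : {poly K}) :
  poly_in i (c *: h) = c *: poly_in i h :> mpoly n K.
Proof. by rewrite linearZ /= mulr_algl. Qed.

(** A polynomial in one variable splits into linear factors. *)
Lemma prime_poly_in P i (h : {poly K}) :
  is_prime_ideal P -> h != 0 -> P (poly_in i h) ->
  exists c, P (poly_in i ('X - c%:P)).
Proof.
move=> Pp h0; have [r ->] := closed_field_poly_normal h.
rewrite poly_inZ -mul_mpolyC => Ph; have [_ P1 PM] := Pp.
case: (PM _ _ Ph) => [/(prime_mpolyC Pp)/eqP|].
  by rewrite lead_coef_eq0 (negPf h0).
elim: r {Ph} => [|c r IHr]; first by rewrite big_nil rmorph1 => /P1.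
by rewrite big_cons rmorphM => /PM[Pc|/IHr //]; exists c.
Qed.

Hypothesis uncountableK : ~ countable [set: K].

(** The coordinate [X_i] of the domain [A = K[X]/P] is a scalar if [X_i - c]
    becomes invertible for all [c] once [f] is inverted. Indeed [A] has
    countable dimension while there are uncountably many inverses
    [f ^- k * g c] of [X_i - c]; infinitely many [c] share the same exponent
    [k] and the same bound on the degree of [g c], so that the [g c] are
    linearly dependent. Clearing denominators in such a relation shows that
    [X_i] satisfies a non-trivial polynomial equation over [K]. *)
Lemma prime_coordinate P f i : is_prime_ideal P -> ~ P f ->
    (forall c, exists k g, P (f ^+ k - g * poly_in i ('X - c%:P))) ->
  exists c, P (poly_in i ('X - c%:P)).
Proof.
move=> Pp Pf inv; have Pi := prime_is_ideal Pp.
pose D kd := [set c | exists2 g, (mmeasure mdeg g <= kd.2)%N &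
  P (f ^+ kd.1 - g * poly_in i ('X - c%:P))].
have [[k d] Dinf] : exists kd, infinite_set (D kd).
  apply: contrapT => /forallNP Dfin; apply: uncountableK.
  suff -> : [set: K] = \bigcup_(kd in [set: nat * nat]) D kd.
    apply: bigcup_countable => // kd _; apply: finite_set_countable.
    exact: contrapT (Dfin kd).
  apply/seteqP; split=> // c _; have [k [g Pg]] := inv c.
  by exists (k, mmeasure mdeg g) => //; exists g.
have [B BD sizeB] := infinite_set_fset #|{: bmultinom n d}|.+1 Dinf.
set N := size _ in sizeB.
pose e (j : 'I_N) : K := nth 0 (finmap.enum_fset B) j.
have e_inj : injective e.
  move=> j l /eqP; rewrite nth_uniq ?finmap.fset_uniq // => /eqP; exact: val_inj.
have /choice[g gP] j : exists g, (mmeasure mdeg g <= d)%N /\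
    P (f ^+ k - g * poly_in i ('X - (e j)%:P)).
  have [|g gd Pg] := BD (e j); last by exists g.
  exact: mem_nth.
have [a [[j0 aj0] ag]] := mpoly_dependence (fun j => (gP j).1) sizeB.
(* The relation with denominators cleared; its value at [e j0] is [a j0]
   times a product of differences of distinct scalars. *)
pose h := \sum_j a j *: \prod_(l | l != j) ('X - (e l)%:P).
apply: (@prime_poly_in P i h) => //.
  apply/eqP => /(congr1 (horner^~ (e j0))); rewrite horner0 /h horner_sum.
  rewrite (bigD1 j0) //= [X in _ + X]big1 ?addr0 => [|j jj0]; last first.
    rewrite hornerZ horner_prod (bigD1 j0) 1?eq_sym //=.
    by rewrite hornerXsubC subrr mul0r mulr0.
  rewrite hornerZ horner_prod => /eqP; rewrite mulf_eq0 (negPf aj0) /=.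
  apply/negP/prodf_neq0 => l lj0; rewrite hornerXsubC subr_eq0.
  by apply: contra lj0 => /eqP/e_inj ->.
have [_ _ PM] := Pp.
have : P (f ^+ k * poly_in i h).
  have -> : f ^+ k * poly_in i h = \sum_j
      (a j *: \prod_(l | l != j) poly_in i ('X - (e l)%:P)) *
        (f ^+ k - g j * poly_in i ('X - (e j)%:P))
      + (\sum_j a j *: g j) * \prod_l poly_in i ('X - (e l)%:P).
    rewrite linear_sum /= mulr_sumr mulr_suml -big_split /=.
    apply: eq_bigr => j _; rewrite poly_inZ rmorph_prod.
    rewrite [X in _ = _ + _ * X](bigD1 j) //= -!mul_mpolyC.
    by move: (\prod_(l | _) _) (poly_in i _) => u v; ring.
  rewrite ag mul0r addr0; apply: ideal_sum => // j.
  by apply: ideal_mull => //; exact: (gP j).2.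
by move=> /PM[/(primeX Pp)|].
Qed.

Lemma poly_in_XsubC i c :
  poly_in i ('X - c%:P) = mpolyX K (mnm1 i) - mpolyC n c.
Proof. by rewrite rmorphB /= horner_algX horner_algC alg_mpolyC. Qed.

(** Modulo the [X_i - z i], every polynomial is its value at [z]. *)
Lemma mpoly_sub_meval P (z : 'I_n -> K) p : is_ideal P ->
    (forall i, P (poly_in i ('X - (z i)%:P))) ->
  P (p - mpolyC n (meval z p)).
Proof.
move=> Pi Pz; pose E p := P (p - mpolyC n (meval z p)).
have EM : forall p q, E p -> E q -> E (p * q).
  move=> {}p q Ep Eq; rewrite /E mevalM mpolyCM.
  have -> : p * q - mpolyC n (meval z p) * mpolyC n (meval z q) =
    q * (p - mpolyC n (meval z p)) +
    mpolyC n (meval z p) * (q - mpolyC n (meval z q)) by ring.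
  by apply: ideal_add => //; exact: ideal_mull.
have EC c : E (mpolyC n c) by rewrite /E mevalC subrr; exact: ideal0.
have E1 : E 1 by rewrite -[1](mpolyC1 n K); exact: EC.
have EX m : E (mpolyX K m).
  rewrite mpolyXE_id; apply: big_ind => // i _; elim: (m i) => [//|k IHk].
  rewrite exprS; apply: EM => //.
  by rewrite /E mevalXU -poly_in_XsubC.
rewrite -/(E p); elim/mpolyind: p => [|c m p _ _ Ep].
  by rewrite -[0](mpolyC0 n K); exact: EC.
have Ecm : E (c *: mpolyX K m) by rewrite -mul_mpolyC; exact: EM.
rewrite /E mevalD mpolyCD opprD addrACA; exact: ideal_add.
Qed.

(** Enlarge [P] to a prime [M] that is maximal among the ideals containing no
    power of [f]. By [prime_coordinate] every coordinate is a scalar modulo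
    [M], so [M] is the ideal of a point. *)
Theorem prime_nullstellensatz P f : is_prime_ideal P -> ~ P f ->
  exists2 z, zeros P z & meval z f != 0.
Proof.
move=> Pp Pf; have Pi := prime_is_ideal Pp.
pose S := [set s | exists k, s = f ^+ k].
have Smul : multiplicative_set S.
  split; first by exists 0%N.
  by move=> _ _ [k ->] [l ->]; exists (k + l)%N; rewrite exprD.
have [_ [k ->] /(primeX Pp)//|M [Mp PM MS Mmeet]] :=
  prime_disjoint (@mpoly_noetherian K n) Smul Pi.
have Mi := prime_is_ideal Mp.
have Mf : ~ M f by apply: MS; exists 1%N.
have /choice[z Mz] i : exists c, M (poly_in i ('X - c%:P)).
  have [//|noc] := pselect (exists c, M (poly_in i ('X - c%:P))).
  apply: prime_coordinate Mp Mf _ => c.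
  have [|_ [g [[k ->] Mg]]] := Mmeet (poly_in i ('X - c%:P)); last by exists k, g.
  by move=> Mc; apply: noc; exists c.
have Meval p := mpoly_sub_meval p Mi Mz.
exists z => [p Pp'|].
  apply: (prime_mpolyC Mp); rewrite -[mpolyC _ _](subKr p).
  by apply: ideal_sub => //; exact: PM.
by apply/eqP => fz; apply: Mf; have := Meval f; rewrite fz mpolyC0 subr0.
Qed.

(** If two closed sets each miss a point of [zeros P], they are contained in
    the zero sets of polynomials [s1] and [s2] outside [P]; then [s1 * s2] is
    outside [P] and does not vanish at some point of [zeros P]. *)
Lemma zeros_prime_irreducible P :
  is_prime_ideal P -> zariski_irreducible (zeros P).
Proof.
move=> Pp; have [Pi P1 PM] := Pp; split.
  by have [z Pz _] := prime_nullstellensatz Pp P1; exists z.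
move=> _ _ [S1 ->] [S2 ->] cover.
apply: contrapT => /not_orP[/nonsubset[z1 [Pz1 /existsNP[s1 /not_implyP[Ss1 sz1]]]]].
move=> /nonsubset[z2 [Pz2 /existsNP[s2 /not_implyP[Ss2 sz2]]]].
have [|z Pz] := prime_nullstellensatz Pp (f := s1 * s2).
  by move=> /PM[/Pz1|/Pz2].
rewrite mevalM mulf_eq0 => /norP[/eqP s1z /eqP s2z].
by have [/(_ _ Ss1)|/(_ _ Ss2)] := cover z Pz.
Qed.

Lemma point_zariski_closed (z : 'I_n -> K) : zariski_closed [set z].
Proof.
exists [set p | exists i, p = poly_in i ('X - (z i)%:P)].
apply/seteqP; split=> [_ -> _ [i ->]|w wz /=].
  by rewrite poly_in_XsubC mevalB mevalXU mevalC subrr.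
apply/funext => i; apply/eqP; rewrite -subr_eq0.
have := wz _ (ex_intro _ i erefl).
by rewrite poly_in_XsubC mevalB mevalXU mevalC => ->.
Qed.

(** Otherwise some prime [Q] containing [P] and [q] contains no non-zero
    polynomial in [X_i]. Then Z(Q) is smaller than Z(P) because of [q], and it
    is not a point because [X_i] is not constant on it; a point, Z(Q) and Z(P)
    form a chain of length two. *)
Lemma dim1_univariate (X : set ('I_n -> K)) P q i :
    has_dim X 1 -> is_prime_ideal P -> zeros P `<=` X -> ~ P q ->
  exists2 r : {poly K}, r != 0 & ideal_adjoin P q (poly_in i r).
Proof.
move=> [_ Xdim] Pp PX Pq; apply: contrapT => nor.
have Pi := prime_is_ideal Pp.
have [Ji PJ Jq] := ideal_adjoinP q Pi.
pose S := [set s : mpoly n K | exists2 r : {poly K}, r != 0 & s = poly_in i r].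
have Smul : multiplicative_set S.
  split; first by exists 1; rewrite ?oner_neq0 ?rmorph1.
  by move=> _ _ [r r0 ->] [s s0 ->]; exists (r * s); rewrite ?mulf_neq0 ?rmorphM.
have [_ [r r0 ->] Jr|Q [Qp JQ QS _]] :=
    prime_disjoint (@mpoly_noetherian K n) Smul Ji; first by apply: nor; exists r.
have zeros_anti (P1 P2 : set (mpoly n K)) : P1 `<=` P2 -> zeros P2 `<=` zeros P1.
  by move=> P12 z Pz p /P12/Pz.
have QP := zeros_anti _ _ (subset_trans PJ JQ).
have [z Qz] : zeros Q !=set0 by have [] := zeros_prime_irreducible Qp.
suff : (2 <= 1)%N by [].
apply: Xdim.
exists (fun k => if k is k'.+1 then if k' is 0%N then zeros Q else zeros P else [set z]).
split=> [[|[|[|//]]] _|[|[|//]] _].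
- split; [exact: point_zariski_closed| |by move=> _ ->; apply: PX; exact: QP].
  split; first by exists z.
  by move=> X1 X2 _ _ /(_ z erefl)[Xz|Xz]; [left|right] => _ ->.
- split; [by exists Q|exact: zeros_prime_irreducible|exact: subset_trans PX].
- by split=> //; [exists P|exact: zeros_prime_irreducible].
- split=> [_ -> //|Qpt].
  have [|w Qw] := prime_nullstellensatz Qp (f := poly_in i ('X - (z i)%:P)).
    by apply: QS; exists ('X - (z i)%:P); rewrite ?polyXsubC_eq0.
  by rewrite poly_in_XsubC mevalB mevalXU mevalC (Qpt _ Qw) subrr eqxx.
- split=> // PQ; have [w Pw] := prime_nullstellensatz Pp Pq.
  by rewrite (PQ _ Pw _ (JQ _ Jq)) eqxx.
Qed.

End Nullstellensatz.

(** A countable set of reals has Lebesgue measure zero, the unit interval has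
    measure one. *)
Lemma uncountable_complex (R : realType) : ~ countable [set: R[i]%C].
Proof.
move=> /countable_injP[f f_inj].
have : countable `[0%R, 1%R : R]%classic.
  apply/countable_injP; exists (fun x => f x%:C%C) => x y _ _ /= /f_inj.
  by rewrite !inE => /(_ Logic.I Logic.I) [].
move=> /countable_lebesgue_measure0; rewrite lebesgue_measure_itv /= lte_fin ltr01.
by rewrite oppr0 adde0 => /eqP; rewrite eqe oner_eq0.
Qed.

(** * Polynomials in commuting operators *)

Section FunctionalCalculus.
Context {K : fieldType} {H : lmodType K} {n : nat}.
Variable V : 'I_n -> {linear H -> H}.
Implicit Types (p q : mpoly n K) (m : multinom n).

Lemma monomial_op_linear m : linear (monomial_op V m).
Proof.
rewrite /monomial_op; apply: (big_ind (fun f : H -> H => linear f)) => //.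
- by move=> f g flin glin a x y /=; rewrite glin flin.
- move=> i _ a x y; elim: (m i) => //= k ->; exact: linearP.
Qed.

(** Sums over different supports are compared by extending both to a common
    list of monomials. *)
Lemma poly_op_seq (s : seq (multinom n)) p x : uniq s -> {subset msupp p <= s} ->
  poly_op V p x = \sum_(m <- s) mcoeff m p *: monomial_op V m x.
Proof.
move=> s_uniq ps; rewrite /poly_op.
rewrite [RHS](bigID (mem (msupp p))) /= [X in _ = _ + X]big1 ?addr0 => [|m]; last first.
  by move=> /memN_msupp_eq0 ->; rewrite scale0r.
rewrite -[RHS]big_filter; apply: perm_big; apply: uniq_perm.
- exact: msupp_uniq.
- exact: filter_uniq.
- by move=> m; rewrite mem_filter; apply/idP/andP => [mp|[]//]; split=> //; exact: ps.
Qed.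

Lemma poly_opP a p q x :
  poly_op V (a *: p + q) x = a *: poly_op V p x + poly_op V q x.
Proof.
pose s := undup (msupp p ++ msupp q).
have s_uniq : uniq s := undup_uniq _.
have ps : {subset msupp p <= s} by move=> m mp; rewrite mem_undup mem_cat mp.
have qs : {subset msupp q <= s} by move=> m mq; rewrite mem_undup mem_cat mq orbT.
have pqs : {subset msupp (a *: p + q) <= s}.
  move=> m; rewrite mcoeff_msupp; apply: contraR => ms.
  have mp : m \notin msupp p by apply: contra ms; exact: ps.
  have mq : m \notin msupp q by apply: contra ms; exact: qs.
  by rewrite mcoeffD mcoeffZ !memN_msupp_eq0 // mulr0 addr0.
rewrite !(@poly_op_seq s) // scaler_sumr -big_split /=; apply: eq_bigr => m _.
by rewrite mcoeffD mcoeffZ scalerDl scalerA.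
Qed.

Lemma poly_op0 x : poly_op V 0 x = 0.
Proof.
by rewrite /poly_op (_ : msupp 0 = [::]) ?big_nil //; apply/eqP; rewrite msupp_eq0.
Qed.

Lemma poly_opD p q x : poly_op V (p + q) x = poly_op V p x + poly_op V q x.
Proof. by rewrite -[p]scale1r poly_opP !scale1r. Qed.

Lemma poly_opZ a p x : poly_op V (a *: p) x = a *: poly_op V p x.
Proof. by rewrite -[a *: p]addr0 poly_opP poly_op0 addr0. Qed.

Lemma poly_opX m x : poly_op V (mpolyX K m) x = monomial_op V m x.
Proof. by rewrite /poly_op msuppX big_seq1 mcoeffX eqxx scale1r. Qed.

Lemma poly_op_linear p : linear (poly_op V p).
Proof.
move=> a x y; rewrite /poly_op scaler_sumr -big_split /=; apply: eq_bigr => m _.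
by rewrite monomial_op_linear scalerDr !scalerA mulrC.
Qed.

Lemma linear_vec0 (f : H -> H) : linear f -> f 0 = 0.
Proof. by move=> /(_ (-1) 0 0); rewrite scaler0 addr0 scaleN1r addNr. Qed.

Lemma poly_op_vec0 p : poly_op V p 0 = 0.
Proof. exact/linear_vec0/poly_op_linear. Qed.

Lemma monomial_op0 x : monomial_op V mnm0 x = x.
Proof.
suff -> : monomial_op V mnm0 = id by [].
apply: (big_ind (fun f : H -> H => f = id)) => // [_ _ -> -> //|i _].
by rewrite mnm0E.
Qed.

Lemma monomial_op1 i x : monomial_op V (mnm1 i) x = V i x.
Proof.
rewrite /monomial_op.
have bigid (s : seq 'I_n) : i \notin s ->
    \big[@comp H H H/idfun]_(j <- s) iter (mnm1 i j) (V j) = id.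
  elim: s => [|j s IHs]; first by rewrite big_nil.
  rewrite inE negb_or big_cons => /andP[ij /IHs ->].
  by rewrite mnm1E (negPf ij).
have : i \in index_enum 'I_n by rewrite mem_index_enum.
elim: (index_enum _) (index_enum_uniq 'I_n) => // j s IHs /= /andP[js s_uniq].
rewrite inE big_cons mnm1E; case: eqVneq => [ij _|ij /= si].
  by rewrite bigid ?ij //= mnm1E ij eqxx.
by rewrite IHs.
Qed.

Hypothesis Vcomm : commuting V.

(** Commutation lets each power of [V i] cross the product of the others. *)
Lemma monomial_opD m1 m2 x :
  monomial_op V (mnm_add m1 m2) x = monomial_op V m1 (monomial_op V m2 x).
Proof.
rewrite /monomial_op.
have iterC i j k l y : iter k (V i) (iter l (V j) y) = iter l (V j) (iter k (V i) y).
  elim: k => //= k ->; elim: l => //= l IHl; by rewrite Vcomm IHl.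
have bigC (s : seq 'I_n) i k (m : multinom n) y :
    iter k (V i) ((\big[@comp H H H/idfun]_(j <- s) iter (m j) (V j)) y) =
    (\big[@comp H H H/idfun]_(j <- s) iter (m j) (V j)) (iter k (V i) y).
  elim: s y => [|j s IHs] y; first by rewrite big_nil.
  by rewrite big_cons /= iterC IHs.
elim: (index_enum _) x => [|i s IHs] x; first by rewrite !big_nil.
by rewrite !big_cons /= IHs mnmDE iterD bigC.
Qed.

Lemma poly_opM p q x : poly_op V (p * q) x = poly_op V p (poly_op V q x).
Proof.
have oplin p1 : linear (poly_op V p1) := poly_op_linear p1.
elim/mpolyind: p => [|c m p _ _ IHp]; first by rewrite mul0r !poly_op0.
rewrite mulrDl -scalerAl !poly_opP {}IHp; congr (_ *: _ + _); rewrite poly_opX.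
elim/mpolyind: q => [|d l q _ _ IHq].
  by rewrite mulr0 !poly_op0 linear_vec0 //; exact: monomial_op_linear.
rewrite mulrDr -scalerAr !poly_opP monomial_op_linear IHq poly_opX -mpolyXD.
by rewrite poly_opX monomial_opD.
Qed.

End FunctionalCalculus.

(** * Orthogonality and closures in Hilbert space *)

Lemma closure_sub (T : topologicalType) (B C : set T) :
  closed C -> B `<=` C -> closure B `<=` C.
Proof. by move=> /closure_id CE BC; rewrite CE; exact: closureS. Qed.

Section HilbertSpace.
Context {R : realType} {H : completeNormedModType R[i]}.
Variable dot : {dot H for Num.conj}.
Hypothesis Hdot : inner_product_of_norm dot.
Implicit Types (x y z : H) (L : set H).

Lemma dot_conj x y : dot x y = (dot y x)^*%R.
Proof. by rewrite (hermC dot x y) expr0 mul1r. Qed.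

Lemma dot_eq0 x : dot x x = 0 -> x = 0.
Proof. by rewrite Hdot => /eqP; rewrite sqrf_eq0 normr_eq0 => /eqP. Qed.

Lemma dotDl x y z : dot (x + y) z = dot x z + dot y z.
Proof. exact: linearDl. Qed.

Lemma dotDr x y z : dot x (y + z) = dot x y + dot x z.
Proof. exact: linearDr. Qed.

Lemma dotZl a x y : dot (a *: x) y = a * dot x y.
Proof. exact: linearZl_LR. Qed.

Lemma dotZr a x y : dot x (a *: y) = a^*%R * dot x y.
Proof. exact: linearZr_LR. Qed.

Lemma dot0l x : dot 0 x = 0. Proof. exact: linear0l. Qed.
Lemma dot0r x : dot x 0 = 0. Proof. exact: linear0r. Qed.

Lemma cauchy_schwarz x y : `|dot x y| <= `|x| * `|y|.
Proof.
have [->|y0] := eqVneq y 0; first by rewrite dot0r !normr0 mulr0.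
have yy0 : dot y y != 0 by apply: contra_neq y0; exact: dot_eq0.
rewrite -(@ler_pXn2r _ 2) ?nnegrE ?mulr_ge0 // exprMn -!Hdot.
pose a := dot x y / dot y y.
have [u [xE uy]] : exists u, x = u + a *: y /\ dot u y = 0.
  exists (x - a *: y); split; first by rewrite subrK.
  by rewrite -scaleNr dotDl dotZl mulNr divfK // subrr.
have -> : dot x x = dot u u + `|a| ^+ 2 * dot y y.
  rewrite xE !(dotDl, dotDr, dotZl, dotZr) uy (dot_conj y u) uy conjC0 normCK.
  by rewrite !mulr0 addr0 add0r mulrA.
rewrite mulrDl -[leLHS]add0r lerD //.
  by rewrite !Hdot mulr_ge0 // exprn_ge0.
rewrite /a normf_div (ger0_norm (_ : 0 <= dot y y)) ?Hdot ?exprn_ge0 // -Hdot.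
by rewrite expr_div_n -mulrA -expr2 divfK // expf_neq0.
Qed.

Lemma continuous_dotl y : continuous (dot^~ y).
Proof.
move=> x; apply/cvgrPdist_lt => e e0; near=> z.
have -> : dot x y - dot z y = dot (x - z) y by rewrite dotDl -scaleN1r dotZl mulN1r.
apply: le_lt_trans (cauchy_schwarz _ _) _.
apply: (@le_lt_trans _ _ (`|x - z| * (`|y| + 1))).
  by rewrite ler_wpM2l // lerDl.
rewrite -ltr_pdivlMr ?ltr_wpDl //.
near: z; apply: cvgr_dist_lt => //; by rewrite divr_gt0 ?ltr_wpDl.
Unshelve. all: by end_near. Qed.

Lemma closed_orth_left y : closed [set x | dot x y = 0].
Proof.
have -> : [set x | dot x y = 0] = dot^~ y @^-1` [set 0] by [].
apply: preimage_closed; last exact: accessible_closed_set1 (hausdorff_accessible _) _.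
by move=> x _; exact: continuous_dotl.
Qed.

(** Being orthogonal to a fixed vector is a closed condition; it is used for
    one argument at a time. *)
Lemma orth_closure (B C : set H) : (forall x y, B x -> C y -> dot x y = 0) ->
  forall x y, closure B x -> closure C y -> dot x y = 0.
Proof.
move=> BC x y Bx Cy.
have BCy z : C z -> dot x z = 0.
  move=> Cz; apply: (closure_sub (@closed_orth_left z) _ Bx) => t Bt; exact: BC.
rewrite dot_conj; apply/eqP; rewrite conjC_eq0; apply/eqP.
apply: (closure_sub (@closed_orth_left x) _ Cy) => z Cz /=.
by rewrite dot_conj BCy // conjC0.
Qed.

(** As for orthogonality, pass to the closure in one argument at a time. *)
Lemma closure_subspace (B : set H) : B 0 ->
    (forall a x y, B x -> B y -> B (a *: x + y)) -> is_subspace (closure B).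
Proof.
move=> B0 BP; split; [exact: subset_closure|move=> a x y Bx By|exact: closed_closure].
have step1 z : B z -> closure B (a *: z + y).
  move=> Bz; have cl : closed ((fun t => a *: z + t) @^-1` closure B).
    apply: preimage_closed; last exact: closed_closure.
    by move=> t _; apply: cvgD; [exact: cvg_cst|exact: cvg_id].
  by apply: (closure_sub cl _ By) => t Bt; apply: subset_closure; exact: BP.
have cl : closed ((fun t => a *: t + y) @^-1` closure B).
  apply: preimage_closed; last exact: closed_closure.
  by move=> t _; apply: cvgD; [apply: cvgZr; exact: cvg_id|exact: cvg_cst].
exact: (closure_sub cl step1 Bx).
Qed.

End HilbertSpace.

(** * Commuting isometries *)

Section IsometricTuples.
Context {R : realType} {H : completeNormedModType R[i]}.
Variable dot : {dot H for Num.conj}.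
Hypothesis Hdot : inner_product_of_norm dot.
Context {n : nat}.
Variable V : 'I_n -> {linear H -> H}.
Hypothesis V_isom : forall i, isometry dot dot (V i).
Hypothesis V_comm : commuting V.
Implicit Types (p q : mpoly n R[i]) (m : multinom n) (x y z : H) (L : set H).

Lemma poly_opC p q x : poly_op V p (poly_op V q x) = poly_op V q (poly_op V p x).
Proof. by rewrite -!poly_opM // mulrC. Qed.

Lemma monomial_op_isometry m x y :
  dot (monomial_op V m x) (monomial_op V m y) = dot x y.
Proof.
move: x y; rewrite /monomial_op.
apply: (big_ind (fun f : H -> H => forall x y, dot (f x) (f y) = dot x y)) => //.
  by move=> f g fP gP x y /=; rewrite fP gP.
by move=> i _ x y; elim: (m i) => //= k <-; exact: V_isom.
Qed.

(** Although [p(V)^*] is not a polynomial in [V], the operator [p(V)^* m(V)]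
    is one for a large enough monomial [m]: the adjoint of [l(V)] cancels the
    factor [l(V)] of [m(V)]. *)
Lemma poly_op_adjoint p : exists q m, forall x y,
  dot (poly_op V p x) (monomial_op V m y) = dot x (poly_op V q y).
Proof.
elim/mpolyind: p => [|c l p _ _ [q [m qP]]].
  by exists 0, mnm0 => x y; rewrite !poly_op0 dot0l dot0r.
exists (c^*%R *: mpolyX _ m + mpolyX _ l * q), (mnm_add l m) => x y.
rewrite !poly_opP poly_opM // dotDl dotZl dotDr dotZr conjCK !poly_opX.
congr (_ * _ + _); first by rewrite monomial_opD // monomial_op_isometry.
by rewrite addmC monomial_opD // qP -poly_opX poly_opC poly_opX.
Qed.

(** The substitute for normality. Using the adjunction once on each side moves
    [q(V)] away: [q(V) x] against [q(V) y] is [q(V) p(V) x] against [m(V) y],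
    that is, [m(V) p(V) x] against [p(V) m(V) y], and [m(V)] is isometric. *)
Lemma poly_op_adjoint_dot p q m :
    (forall x y, dot (poly_op V p x) (monomial_op V m y) = dot x (poly_op V q y)) ->
  forall x y, dot (poly_op V q x) (poly_op V q y) = dot (poly_op V p x) (poly_op V p y).
Proof.
move=> pq x y; rewrite -pq poly_opC dot_conj -pq.
by rewrite -[monomial_op V m y]poly_opX poly_opC poly_opX monomial_op_isometry -dot_conj.
Qed.

(** With [p'] the adjoint companion of [p], the inner product is that of a
    vector with [p'(V) q(V) y], whose norm is the norm of [p(V) q(V) y]. *)
Lemma ann_mul_orth p q : ann V (p * q) ->
  forall x y, dot (poly_op V p x) (poly_op V q y) = 0.
Proof.
move=> pq x y; have [p' [m pp']] := poly_op_adjoint p.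
rewrite -(monomial_op_isometry m) -[X in dot X _]poly_opX poly_opC poly_opX pp'.
rewrite (_ : poly_op V p' _ = 0) ?dot0r //; apply: (dot_eq0 Hdot).
by rewrite (poly_op_adjoint_dot pp') -poly_opM // pq // dot0l.
Qed.

Lemma ann_on_ideal L : is_ideal (ann_on V L).
Proof.
split=> [x _|a p q pL qL x Lx]; first by rewrite poly_op0.
by rewrite poly_opD poly_opM // pL // qL // addr0 poly_op_vec0.
Qed.

Lemma ann_radical : is_radical (ann V).
Proof.
apply: radical_of_square => [|p pp x _]; first exact: ann_on_ideal.
by apply: (dot_eq0 Hdot); exact: ann_mul_orth.
Qed.

Lemma isometry_norm (T : H -> H) : isometry dot dot T -> forall x, `|T x| = `|x|.
Proof.
move=> Tisom x; apply/eqP; rewrite -(@eqrXn2 _ 2) //.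
by rewrite -!Hdot Tisom.
Qed.

Lemma monomial_op_continuous m : continuous (monomial_op V m).
Proof.
move=> x; apply/cvgrPdist_lt => e e0; near=> z.
have -> : monomial_op V m x - monomial_op V m z = monomial_op V m (x - z).
  by rewrite addrC -scaleN1r -monomial_op_linear scaleN1r addrC.
rewrite isometry_norm; last by move=> ? ?; exact: monomial_op_isometry.
by near: z; exact: cvgr_dist_lt.
Unshelve. all: by end_near. Qed.

Lemma poly_op_continuous p : continuous (poly_op V p).
Proof.
elim/mpolyind: p => [x|c m p _ _ IHp x].
  rewrite (_ : poly_op V 0 = cst 0); first exact: cvg_cst.
  by apply/funext => y; rewrite poly_op0.
rewrite (_ : poly_op V _ = fun y => c *: monomial_op V m y + poly_op V p y).
  by apply: cvgD; [apply: cvgZr; exact: monomial_op_continuous|exact: IHp].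
by apply/funext => y; rewrite poly_opP poly_opX.
Qed.

Definition range_closure p : set H := closure (range (poly_op V p)).

Lemma mem_range_closure p x : range_closure p (poly_op V p x).
Proof. by apply: subset_closure; exists x. Qed.

Lemma range_closure_subspace p : is_subspace (range_closure p).
Proof.
apply: closure_subspace; first by exists 0; rewrite ?poly_op_vec0.
move=> a _ _ [x _ <-] [y _ <-]; exists (a *: x + y) => //.
exact: poly_op_linear.
Qed.

Lemma closed_poly_op_preimage p (C : set H) :
  closed C -> closed (poly_op V p @^-1` C).
Proof. by apply: preimage_closed => x _; exact: poly_op_continuous. Qed.

Lemma range_closure_invariant p : is_invariant V (range_closure p).
Proof.
move=> i x px; rewrite -monomial_op1 -poly_opX.
have cl := @closed_poly_op_preimage (mpolyX _ (mnm1 i)) _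
  (@closed_closure _ (range (poly_op V p))).
apply: (closure_sub cl _ px).
by move=> _ [y _ <-] /=; rewrite poly_opC //; exact: mem_range_closure.
Qed.

(** By continuity [q(V)] vanishes on the closure as soon as it does on the
    range. *)
Lemma ann_on_range_closure p q : ann_on V (range_closure p) q <-> ann V (q * p).
Proof.
split=> [qp x _|qp x px].
  by rewrite poly_opM //; apply: qp; exact: mem_range_closure.
have cl : closed (poly_op V q @^-1` [set 0]).
  apply: closed_poly_op_preimage.
  exact: accessible_closed_set1 (hausdorff_accessible _) _.
apply: (closure_sub cl _ px) => _ [y _ <-] /=.
by rewrite -poly_opM // qp.
Qed.

Lemma range_closure_eq0 p : range_closure p = [set 0] -> ann V p.
Proof. by move=> p0 x _; have := @mem_range_closure p x; rewrite p0. Qed.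

Lemma range_closure_orth p q : ann V (p * q) ->
  forall x y, range_closure p x -> range_closure q y -> dot x y = 0.
Proof.
move=> pq; apply: (orth_closure Hdot) => _ _ [x _ <-] [y _ <-].
exact: ann_mul_orth.
Qed.

Section Invariant.
Variable L : set H.
Hypothesis L_sub : is_subspace L.
Hypothesis L_inv : is_invariant V L.

Lemma poly_op_invariant p x : L x -> L (poly_op V p x).
Proof.
have [L0 LP _] := L_sub.
elim/mpolyind: p => [|c m p _ _ IHp] Lx; first by rewrite poly_op0.
rewrite poly_opP poly_opX; apply: LP; last exact: IHp.
move: x Lx {IHp}; apply: (big_ind (fun f : H -> H => forall x, L x -> L (f x))) => //.
  by move=> f g fL gL x Lx; apply/fL/gL.
by move=> i _ x Lx; elim: (m i) => //= k; exact: L_inv.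
Qed.

Lemma isometry_inj i x : V i x = 0 -> x = 0.
Proof.
move=> Vx; apply: (dot_eq0 Hdot); have := V_isom i x x; rewrite Vx => <-.
exact: dot0l.
Qed.

(** Powers of the variable can be cancelled from [r], since [V i] is injective.
    Once the constant term [c] of the polynomial is non-zero, the relation
    [V_i r(V_i) x + c x = 0] exhibits [x] as a value of [V i]. *)
Lemma algebraic_isometry_onto i (r : {poly R[i]}) :
  r != 0 -> ann_on V L (poly_in i r) -> L `<=` V i @` L.
Proof.
have [L0 LP _] := L_sub.
elim/poly_ind: r => [|r c IHr]; first by rewrite eqxx.
have rcE x : poly_op V (poly_in i (r * 'X + c%:P)) x =
    V i (poly_op V (poly_in i r) x) + c *: x.
  rewrite rmorphD rmorphM /= horner_algX horner_algC poly_opD poly_opZ.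
  congr (_ + _ *: _).
    by rewrite mulrC poly_opM // poly_opX monomial_op1.
  by rewrite -mpolyX0 poly_opX monomial_op0.
have [-> r0 rann|c0 _ rann x Lx] := eqVneq c 0.
  apply: IHr => [|x Lx].
    by apply: contraNneq r0 => ->; rewrite mul0r addr0.
  apply: (@isometry_inj i); have := rann x Lx.
  rewrite [_ + 0%:P]addr0 rmorphM /= horner_algX mulrC poly_opM //.
  by rewrite poly_opX monomial_op1.
exists ((- c^-1) *: poly_op V (poly_in i r) x).
  by rewrite -[_ *: _]addr0; apply: LP => //; exact: poly_op_invariant.
have := rann x Lx; rewrite rcE => /eqP; rewrite addr_eq0 => /eqP rx.
by rewrite linearZ /= rx scalerN scaleNr opprK scalerA mulVf // scale1r.
Qed.

(** A vector orthogonal to [L] is mapped by the isometry [V i] to one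
    orthogonal to the image of [L], which is [L]. *)
Lemma algebraic_reducing_unitary :
    (forall i, exists2 r : {poly R[i]}, r != 0 & ann_on V L (poly_in i r)) ->
  reducing dot V L /\ forall i, unitary_on dot L (V i).
Proof.
move=> alg.
have onto i : V i @` L = L.
  apply/seteqP; split=> [_ [x Lx <-]|]; first exact: L_inv.
  by have [r r0 rann] := alg i; exact: algebraic_isometry_onto rann.
split=> [|i]; last by split=> // x y _ _; exact: V_isom.
split=> // i y Ly x; rewrite -(onto i) => -[z Lz <-].
exact: etrans (V_isom i z y) (Ly z Lz).
Qed.

End Invariant.
End IsometricTuples.

(** * The annihilator and its prime factors *)

Theorem theorem3p4 (R : realType) (H : completeNormedModType R[i])
    (dot : {dot H for Num.conj}) (Hdot : inner_product_of_norm dot)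
    (n : nat) (n_gt0 : (0 < n)%N)
    (V : 'I_n -> {linear H -> H})
    (V_isom : forall i, isometry dot dot (V i))
    (V_comm : commuting V)
    (V_cnu : completely_non_unitary dot V)
    (I : set (mpoly n R[i]))
    (I_ideal : is_ideal I)
    (I_ann : I `<=` ann V)
    (I_dim : has_dim (zeros I) 1) :
  (I = ann V <->
     is_radical I /\
     exists (m : nat) (P : 'I_m -> set (mpoly n R[i])),
       are_prime_factors I P /\
       forall j, ~ (bigcap_except P j `<=` ann V)) /\
  (I = ann V ->
     forall (m : nat) (P : 'I_m -> set (mpoly n R[i])),
       are_prime_factors I P ->
       exists L : 'I_m -> set H,
         [/\ forall j, is_subspace (L j) /\ L j <> [set 0],
             forall j, is_invariant V (L j),
             forall j k, j != k ->
               forall x y, L j x -> L k y -> dot x y = 0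
           & forall j, P j = ann_on V (L j)]).
Proof.
(* Elements of [P j] become elements of [I], hence annihilate the range of
   [p(V)], once multiplied by [p]. *)
have mem_capM m (P : 'I_m -> set (mpoly n R[i])) j p q :
    are_prime_factors I P -> bigcap_except P j p -> P j q -> I (q * p).
  move=> [Pp PI _] capp Pq; rewrite -PI => i _.
  have Pi := prime_is_ideal (Pp i).
  have [->|ij] := eqVneq i j; first by apply: ideal_mulr => //; exact: prime_is_ideal.
  by apply: ideal_mull => //; exact: capp.
split; last first.
  move=> IV m P PF; have [Pp PI Pirr] := PF.
  have /choice[p pP] j : exists p, bigcap_except P j p /\ ~ I p.
    have [_ /nonsubset[p [capp Ip]]] := Pirr j; by exists p.
  have Pjp j : ~ P j (p j).
    move=> Pjp; apply: (pP j).2; rewrite -PI => i _.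
    by have [->//|ij] := eqVneq i j; exact: (pP j).1.
  (* Outside [I] but in the other factors, [p j] is outside the prime [P j], so
     that it can be cancelled from [q * p j] in [P j]. *)
  exists (fun j => range_closure V (p j)); split=> [j|j|j k jk|j].
  - split; first exact: range_closure_subspace.
    by move=> /range_closure_eq0; rewrite -IV; exact: (pP j).2.
  - exact: (@range_closure_invariant _ _ _ Hdot _ _ V_isom V_comm).
  - apply: range_closure_orth => //; rewrite -IV.
    apply: (mem_capM _ _ k) => //; first exact: (pP k).1.
    by apply: (pP j).1; rewrite /= eq_sym.
  - apply/seteqP; split=> q.
      move=> Pq; apply/(ann_on_range_closure Hdot V_isom V_comm); rewrite -IV.
      by apply: (mem_capM _ _ j) => //; exact: (pP j).1.
    move=> /(ann_on_range_closure Hdot V_isom V_comm); rewrite -IV -PI.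
    by have [_ _ PM] := Pp j; move=> /(_ j Logic.I)/PM[|/Pjp].
split=> [IV|[Irad [m [P [PF Pann]]]]].
  have Irad : is_radical I by rewrite IV; exact: ann_radical.
  split=> //; have [m [P PF]] := radical_prime_factors (@mpoly_noetherian _ n) Irad.
  exists m, P; split=> // j; rewrite -IV; by case: PF => _ _ /(_ j)[].
apply/seteqP; split=> // q qann; have [Pp PI _] := PF.
rewrite -PI => j _; apply: contrapT => Pq; apply: (Pann j) => p capp.
apply: range_closure_eq0.
have PL : P j `<=` ann_on V (range_closure V p).
  move=> r Pr; apply/(ann_on_range_closure Hdot V_isom V_comm).
  by apply: I_ann; exact: mem_capM PF capp Pr.
have qL : ann_on V (range_closure V p) q.
  apply/(ann_on_range_closure Hdot V_isom V_comm).
  by rewrite mulrC; apply: (@ideal_mull _ (ann V)) => //; exact: ann_on_ideal.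
apply: contrapT => L0; apply: V_cnu; exists (range_closure V p).
have [|Lred Luni] := algebraic_reducing_unitary Hdot V_isom V_comm
  (range_closure_subspace V p) (range_closure_invariant Hdot V_isom V_comm (p := p)); last by split.
move=> i.
have PI' : zeros (P j) `<=` zeros I.
  by move=> z Pz r; rewrite -PI => /(_ j Logic.I)/Pz.
have [r r0 [b Pr]] :=
  dim1_univariate (@uncountable_complex R) i I_dim (Pp j) PI' Pq.
exists r => //; rewrite -(subrK (b * q) (poly_in i r)).
have Li := ann_on_ideal V_comm (range_closure V p).
exact: (ideal_add Li (PL _ Pr) (ideal_mull b Li qL)).
Qed.
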